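(* Let $n$ be a positive integer, let $\mathcal{D}_{(n)}$ be the set of all set systems with ground set $[n]$, and let $\mathcal{G}=\langle \ast,+\mid \ast^2,+^2,(\ast+)^3\rangle\cong S_3$. Define $\phi:S_n\to \operatorname{Aut}(\mathcal{G}^n)$ by $\phi(\pi)=\phi_\pi$, where $\phi_\pi(\hat g)=\hat g\pi^{-1}$ for $\hat g\in\mathcal{G}^n$. Then $\phi$ is a group homomorphism, and the semidirect product $\mathcal{G}^n\rtimes_\phi S_n$, with multiplication $(\hat g,\pi_1)(\hat h,\pi_2)=(\hat g\circ \hat h\pi_1^{-1},\pi_1\pi_2)$, acts (on the left) on $\mathcal{D}_{(n)}$ by $$(\hat g,\pi)D=\hat g\cdot(\pi D)=\hat g\cdot D_\pi=D_\pi\Gamma(\hat g).$$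
   Context: A set system with ground set $[n]=\{1,\dots,n\}$ is a pair $D=([n],\mathcal{F})$ with $\mathcal{F}$ any collection of subsets of $[n]$ (the feasible sets). For $i\in[n]$: the twist is $D\ast i=([n],\{X\triangle\{i\}: X\in\mathcal{F}\})$; the loop complementation is $D+i=([n],\mathcal{F}\triangle\{I\cup\{i\}: I\in\mathcal{F},\ i\notin I\})$. For fixed $i$ the operations $\ast i$ and $+i$ are involutions on set systems satisfying the relations of $\mathcal{G}$. For a word $g=g_1g_2\cdots g_k$ in $\{\ast,+\}$ put $D\,g\,i:=(\cdots(D\,g_k\,i)\,g_{k-1}\,i\cdots)\,g_1\,i$ (rightmost letter applied first); this depends only on the element $g\in\mathcal{G}$. Operations on distinct elements $i\ne j$ commute. An element $\hat g=(g_1,\dots,g_n)\in\mathcal{G}^n$ is viewed as a map $[n]\to\mathcal{G}$, $\hat g(i)=g_i$; multiplication $\circ$ in $\mathcal{G}^n$ is componentwise. $\hat g\cdot D=D\,\Gamma(\hat g)$ denotes the set system obtained from $D$ by applying $g_i$ to element $i$, for every $i\in[n]$ (in any order). For $\pi\in S_n$, $\pi D=D_\pi=([n],\{\pi(I): I\in\mathcal{F}\})$, and $\hat g\pi^{-1}$ is the reindexing $(\hat g\pi^{-1})(i)=g_{\pi^{-1}(i)}$. Permutations are composed as functions. *)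

(* Defs.v *)
From HB Require Import structures.
From mathcomp Require Import all_boot all_fingroup.

Set Implicit Arguments.
Unset Strict Implicit.
Unset Printing Implicit Defensive.

Import GroupScope.
Local Open Scope quotient_scope.

Inductive letter := Star | Plus.

Definition letter_code l := if l is Star then true else false.
Definition letter_decode (b : bool) := if b then Star else Plus.
Lemma letter_codeK : cancel letter_code letter_decode. Proof. by case. Qed.
HB.instance Definition _ := Countable.copy letter (can_type letter_codeK).

(** The group G = < *, + | *^2, +^2, ( *+ )^3 >.  Both generators are involutions,
    so every element is represented by a word without inverse letters, and G
    is the quotient of the free monoid on {*, +} by the congruence generated
    by the relators. *)

Notation word := (seq letter).

Inductive relator : word -> Prop :=
  | relator_star2 : relator [:: Star; Star]
  | relator_plus2 : relator [:: Plus; Plus]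
  | relator_star_plus3 : relator [:: Star; Plus; Star; Plus; Star; Plus].

Inductive word_cong : word -> word -> Prop :=
  | cong_relator r : relator r -> word_cong r [::]
  | cong_refl u : word_cong u u
  | cong_sym u v : word_cong u v -> word_cong v u
  | cong_trans v u w : word_cong u v -> word_cong v w -> word_cong u w
  | cong_cat u1 u2 v1 v2 :
      word_cong u1 v1 -> word_cong u2 v2 -> word_cong (u1 ++ u2) (v1 ++ v2).

(** [word_cong] is decided by computing reduced forms: [push l w] is the reduced
    form of [l :: w] when [w] is one of the six reduced words. *)

Definition push (l : letter) (w : word) : word :=
  match l, w with
  | Star, [::] => [:: Star]
  | Star, [:: Star] => [::]
  | Star, [:: Star; Plus] => [:: Plus]
  | Star, [:: Plus; Star] => [:: Star; Plus; Star]
  | Star, [:: Star; Plus; Star] => [:: Plus; Star]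
  | Star, [:: Plus] => [:: Star; Plus]
  | Plus, [::] => [:: Plus]
  | Plus, [:: Plus] => [::]
  | Plus, [:: Plus; Star] => [:: Star]
  | Plus, [:: Star; Plus] => [:: Star; Plus; Star]
  | Plus, [:: Star; Plus; Star] => [:: Star; Plus]
  | Plus, [:: Star] => [:: Plus; Star]
  | _, _ => w
  end.

Definition reduced_words : seq word :=
  [:: [::]; [:: Star]; [:: Plus]; [:: Star; Plus]; [:: Plus; Star];
      [:: Star; Plus; Star]].

Definition reduce (w : word) : word := foldr push [::] w.

Lemma reduced_ind (P : word -> Prop) :
  P [::] -> P [:: Star] -> P [:: Plus] -> P [:: Star; Plus] ->
  P [:: Plus; Star] -> P [:: Star; Plus; Star] ->
  forall w, w \in reduced_words -> P w.
Proof.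
move=> P1 P2 P3 P4 P5 P6 w; rewrite !inE.
by case/or4P=> [|||/or3P[]] /eqP->.
Qed.

Lemma push_reduced l w : w \in reduced_words -> push l w \in reduced_words.
Proof. by move: w; apply: reduced_ind; case: l. Qed.

Lemma reduce_reduced w : reduce w \in reduced_words.
Proof. by elim: w => //= l w; apply: push_reduced. Qed.

Lemma cong_ctx x y u v :
  word_cong u v -> word_cong (x ++ u ++ y) (x ++ v ++ y).
Proof.
by move=> uv; apply: cong_cat (cong_refl x) (cong_cat uv (cong_refl y)).
Qed.

Lemma cong_braid : word_cong [:: Plus; Star; Plus] [:: Star; Plus; Star].
Proof.
have S2 := cong_relator relator_star2; have P2 := cong_relator relator_plus2.
apply: cong_trans (cong_sym (@cong_ctx [::] [:: Plus; Star; Plus] _ _ S2)) _.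
apply: cong_trans
  (cong_sym (@cong_ctx [:: Star; Star; Plus; Star; Plus] [::] _ _ S2)) _.
apply: cong_trans (cong_sym
  (@cong_ctx [:: Star; Star; Plus; Star; Plus; Star] [:: Star] _ _ P2)) _.
exact: (@cong_ctx [:: Star] [:: Plus; Star] _ _
          (cong_relator relator_star_plus3)).
Qed.

Lemma push_cong l w : w \in reduced_words -> word_cong (l :: w) (push l w).
Proof.
have S2 v : word_cong [:: Star, Star & v] v.
  apply: (@cong_cat [:: Star; Star] v [::]); last exact: cong_refl.
  exact/cong_relator/relator_star2.
have P2 v : word_cong [:: Plus, Plus & v] v.
  apply: (@cong_cat [:: Plus; Plus] v [::]); last exact: cong_refl.
  exact/cong_relator/relator_plus2.
have B v : word_cong [:: Plus, Star, Plus & v] [:: Star, Plus, Star & v].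
  apply: (@cong_cat [:: Plus; Star; Plus] v [:: Star; Plus; Star]).
    exact: cong_braid.
  exact: cong_refl.
move: w; apply: reduced_ind; case: l => /=;
  try exact: cong_refl; try exact: S2; try exact: P2; try exact: B.
apply: cong_trans (B _) _.
exact: (cong_cat (cong_refl [:: Star; Plus]) (S2 [::])).
Qed.

Lemma reduce_cong w : word_cong w (reduce w).
Proof.
elim: w => [|l w IHw]; first exact: cong_refl.
apply: cong_trans (push_cong l (reduce_reduced w)).
exact: (cong_cat (cong_refl [:: l]) IHw).
Qed.

Lemma cong_reduce u v : word_cong u v -> reduce u = reduce v.
Proof.
have pushK r w : relator r -> w \in reduced_words -> foldr push w r = w.
  by move=> rel_r; move: w; apply: reduced_ind; case: rel_r.
have reduce_cat x y : reduce (x ++ y) = foldr push (reduce y) (reduce x).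
  rewrite /reduce foldr_cat -/(reduce y); elim: x => //= l x ->.
  rewrite -/(reduce x).
  move: (reduce x) (reduce_reduced x) (reduce y) (reduce_reduced y).
  by apply: reduced_ind; apply: reduced_ind; case: l.
elim=> {u v} //.
- by move=> r /pushK; apply.
- by move=> v u w _ -> _ ->.
- by move=> u1 u2 v1 v2 _ e1 _ e2; rewrite !reduce_cat e1 e2.
Qed.

Lemma word_cong_dec u v : decidable (word_cong u v).
Proof.
have [e|ne] := eqVneq (reduce u) (reduce v); [left | right=> /cong_reduce/eqP].
  apply: cong_trans (reduce_cong u) _; rewrite e; exact/cong_sym/reduce_cong.
by apply/negP.
Qed.

Definition word_equiv (u v : word) : bool := word_cong_dec u v.

Lemma word_equivP u v : reflect (word_cong u v) (word_equiv u v).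
Proof. exact: sumboolP. Qed.

Lemma word_equiv_refl : reflexive word_equiv.
Proof. by move=> u; apply/word_equivP/cong_refl. Qed.
Lemma word_equiv_sym : symmetric word_equiv.
Proof. by move=> u v; apply/word_equivP/word_equivP; apply: cong_sym. Qed.
Lemma word_equiv_trans : transitive word_equiv.
Proof.
by move=> v u w /word_equivP uv /word_equivP vw; apply/word_equivP/(cong_trans uv).
Qed.
Canonical word_equiv_rel :=
  EquivRel word_equiv word_equiv_refl word_equiv_sym word_equiv_trans.

Definition G := {eq_quot word_equiv}.
HB.instance Definition _ := Choice.on G.
HB.instance Definition _ := EqQuotient.on G.

Definition Gword (w : word) : G := \pi_G w.
Definition Grepr (g : G) : word := generic_quotient.repr g.

Lemma Gword_eq u v : (Gword u = Gword v) <-> word_cong u v.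
Proof.
split=> [/eqP|/word_equivP uv]; last by apply/eqP; rewrite /Gword piE.
by rewrite /Gword piE => /word_equivP.
Qed.

Lemma GwordK (g : G) : Gword (Grepr g) = g. Proof. exact: reprK. Qed.

Lemma Grepr_Gword w : word_cong (Grepr (Gword w)) w.
Proof. by apply/Gword_eq; rewrite GwordK. Qed.

Definition Gmul (g h : G) : G := Gword (Grepr g ++ Grepr h).
Definition Gone : G := Gword [::].
Definition Ginv (g : G) : G := Gword (rev (Grepr g)).

Lemma Gword_cat u v : Gmul (Gword u) (Gword v) = Gword (u ++ v).
Proof. by apply/Gword_eq; apply: cong_cat; apply: Grepr_Gword. Qed.

Lemma GmulA : associative Gmul.
Proof.
move=> x y z; rewrite -(GwordK x) -(GwordK y) -(GwordK z).
by rewrite !Gword_cat catA.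
Qed.

Lemma Gmul1g : left_id Gone Gmul.
Proof. by move=> x; rewrite -(GwordK x) Gword_cat. Qed.

Lemma Gmulg1 : right_id Gone Gmul.
Proof. by move=> x; rewrite -(GwordK x) Gword_cat cats0. Qed.

Lemma word_catV w : word_cong (w ++ rev w) [::].
Proof.
elim: w => [|l w IHw]; first exact: cong_refl.
rewrite rev_cons -cats1 /= catA -(cat1s l).
apply: (@cong_trans ([:: l] ++ [::] ++ [:: l])).
  by apply: cong_cat (cong_refl _) _; apply: cong_cat IHw (cong_refl _).
by case: l; apply: cong_relator; constructor.
Qed.

Lemma GmulgV : right_inverse Gone Ginv Gmul.
Proof.
move=> x; rewrite -{1}(GwordK x) Gword_cat.
exact/Gword_eq/word_catV.
Qed.

Lemma GmulVg : left_inverse Gone Ginv Gmul.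
Proof.
move=> x; rewrite -{2}(GwordK x) Gword_cat; apply/Gword_eq.
by rewrite -{2}(revK (Grepr x)); apply: word_catV.
Qed.

HB.instance Definition _ :=
  isGroup.Build G GmulA Gmul1g Gmulg1 GmulVg GmulgV.

Lemma Genum_axiom : Finite.axiom (map Gword reduced_words).
Proof.
move=> g; rewrite count_uniq_mem.
  rewrite -(GwordK g); apply/eqP; rewrite eqb1; apply/mapP.
  exists (reduce (Grepr g)); first exact: reduce_reduced.
  exact/Gword_eq/reduce_cong.
rewrite map_inj_in_uniq // => u v ur vr /Gword_eq/cong_reduce.
have redK w : w \in reduced_words -> reduce w = w.
  by move: w; apply: reduced_ind.
by rewrite !redK.
Qed.

HB.instance Definition _ := CanIsCountable (GwordK : cancel Grepr Gword).
HB.instance Definition _ := isFinite.Build G Genum_axiom.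

Lemma word_cong_perm (T : finType) (s p : {perm T}) (u v : word) :
  s ^+ 2 = 1 -> p ^+ 2 = 1 -> (s * p) ^+ 3 = 1 -> word_cong u v ->
  \prod_(l <- u) (if l is Star then s else p) =
  \prod_(l <- v) (if l is Star then s else p).
Proof.
move=> s2 p2 sp3; elim=> {u v} //.
- by move=> r []; rewrite !big_cons !big_nil mulg1 // -?expg2 //;
     rewrite -sp3 expgS expg2 !mulgA.
- by move=> v u w _ -> _ ->.
- by move=> u1 u2 v1 v2 _ e1 _ e2; rewrite !big_cat /= e1 e2.
Qed.

Lemma G_isog_S3 : [set: G] \isog [set: 'S_3].
Proof.
pose o (k : nat) : 'I_3 := inord k.
pose s : 'S_3 := tperm (o 0%N) (o 1%N); pose p : 'S_3 := tperm (o 1%N) (o 2%N).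
pose ev (w : word) := \prod_(l <- w) (if l is Star then s else p).
have oE i j : i < 3 -> j < 3 -> (o i == o j) = (i == j).
  by move=> i3 j3; rewrite -val_eqE /= !inordK.
have s2 : s ^+ 2 = 1 by rewrite expg2 tperm2.
have p2 : p ^+ 2 = 1 by rewrite expg2 tperm2.
have eq3 (a b : 'S_3) : (forall i, i < 3 -> a (o i) = b (o i)) -> a = b.
  by move=> ab; apply/permP=> i; rewrite -(inord_val i); apply: ab.
have sE i : i < 3 -> s (o i) = o (nth 0%N [:: 1; 0; 2]%N i).
  by case: i => [|[|[|//]]] _; rewrite permE /= !oE.
have pE i : i < 3 -> p (o i) = o (nth 0%N [:: 0; 2; 1]%N i).
  by case: i => [|[|[|//]]] _; rewrite permE /= !oE.
have sp3 : (s * p) ^+ 3 = 1.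
  by apply: eq3 => -[|[|[|//]]] _; rewrite !expgS expg0 mulg1 !permM perm1 !(sE, pE).
have evP u v : word_cong u v -> ev u = ev v by apply: word_cong_perm.
pose f (g : G) := ev (Grepr g).
have fM : {in [set: G] &, {morph f : x y / x * y}}.
  by move=> x y _ _; rewrite /f /ev -big_cat; apply/evP/Grepr_Gword.
have f_inj : 'injm (Morphism fM).
  apply/injmP=> x y _ _ /= fxy; rewrite -(GwordK x) -(GwordK y).
  apply/Gword_eq; move: fxy.
  rewrite /f (evP _ _ (reduce_cong (Grepr x))) (evP _ _ (reduce_cong (Grepr y))).
  move=> e; apply: cong_trans (reduce_cong _) _.
  apply: cong_trans (cong_sym (reduce_cong _)).
  suff -> : reduce (Grepr x) = reduce (Grepr y) by exact: cong_refl.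
  move: (reduce (Grepr x)) (reduce_reduced (Grepr x)) (reduce (Grepr y))
    (reduce_reduced (Grepr y)) e.
  apply: reduced_ind; apply: reduced_ind => // /permP e;
    move: (e (o 0%N)) (e (o 1%N)); rewrite /ev ?big_cons ?big_nil;
    rewrite ?(permM, perm1) ?(sE, pE) //= => /eqP + /eqP;
    by rewrite !oE.
apply/isogP; exists (Morphism fM) => //.
apply/eqP; rewrite eqEcard subsetT card_injm //=.
by rewrite !cardsT card_Sn [leqRHS]cardT enumT unlock.
Qed.

(** G^n, with the library's componentwise multiplication. *)
Definition Gn (n : nat) := {ffun 'I_n -> G}.
HB.instance Definition _ n := Finite.on (Gn n).
HB.instance Definition _ n := Group.on (Gn n).

(** The ground set [n] = {1, ..., n} is represented by ['I_n]; a set system is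
    its collection of feasible sets. *)

Definition set_system (n : nat) := {set {set 'I_n}}.

Definition symdiff (T : finType) (A B : {set T}) : {set T} :=
  (A :\: B) :|: (B :\: A).

Lemma in_symdiff (T : finType) (A B : {set T}) x :
  (x \in symdiff A B) = (x \in A) (+) (x \in B).
Proof. by rewrite !inE; do 2!case: (_ \in _). Qed.

Section SetSystemOperations.
Variable n : nat.
Implicit Types (D : set_system n) (i : 'I_n) (w : word).

Definition twist D i : set_system n := [set symdiff X [set i] | X in D].

Definition loop_compl D i : set_system n :=
  symdiff D [set i |: I | I in D & i \notin I].

Definition letter_op (l : letter) : set_system n -> 'I_n -> set_system n :=
  if l is Star then twist else loop_compl.

(** The rightmost letter is applied first. *)
Definition word_op D w i : set_system n :=
  foldr (fun l E => letter_op l E i) D w.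

Definition elt_op D (g : G) i : set_system n := word_op D (Grepr g) i.

Definition Gamma D (g : Gn n) : set_system n :=
  foldr (fun i E => elt_op E (g i) i) D (enum 'I_n).

Definition perm_sys (s : 'S_n) D : set_system n := [set s @: I | I : {set 'I_n} in D].

(** [elt_op] and [Gamma] depend neither on the representative words nor on the
    order in which the elements of the ground set are processed. *)

Definition tog (X : {set 'I_n}) i := symdiff X [set i].

Lemma in_tog X i j : (j \in tog X i) = (j \in X) (+) (j == i).
Proof. by rewrite in_symdiff inE. Qed.

Lemma togK i : involutive (tog^~ i).
Proof. by move=> X; apply/setP=> j; rewrite !in_tog -addbA addbb addbF. Qed.

Lemma togC X i j : tog (tog X i) j = tog (tog X j) i.
Proof. by apply/setP=> k; rewrite !in_tog -!addbA [(k == i) (+) _]addbC. Qed.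

Lemma in_twist D i X : (X \in twist D i) = (tog X i \in D).
Proof.
rewrite -{1}[X](togK i).
exact: (@mem_imset _ _ (tog^~ i) D (tog X i) (can_inj (togK i))).
Qed.

Lemma in_loop_compl D i X :
  (X \in loop_compl D i) = (X \in D) (+) ((i \in X) && (tog X i \in D)).
Proof.
rewrite in_symdiff; congr (_ (+) _); apply/imsetP/andP=> [[Y]|[iX XD]].
  rewrite inE => /andP[YD iY] ->; rewrite setU11; split=> //.
  suff -> : tog (i |: Y) i = Y by [].
  apply/setP=> j; rewrite in_tog in_setU1; case: eqVneq => [->|_] /=.
    by rewrite (negPf iY).
  by rewrite addbF.
exists (tog X i); first by rewrite inE XD in_tog eqxx iX.
apply/setP=> j; rewrite in_setU1 in_tog; case: eqVneq => [->|_] /=.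
  by rewrite iX.
by rewrite addbF.
Qed.

Lemma in_togi X i : (i \in tog X i) = (i \notin X).
Proof. by rewrite in_tog eqxx addbT. Qed.

Lemma relator_op r D i : relator r -> word_op D r i = D.
Proof.
case=> {r}; apply/setP=> X; rewrite /= !(in_twist, in_loop_compl) ?togK //;
  rewrite ?in_togi ?togK.
- by case: (i \in X); case: (X \in D); case: (tog X i \in D).
- by case: (i \in X); case: (X \in D); case: (tog X i \in D).
Qed.

Lemma word_op_cong D i u v : word_cong u v -> word_op D u i = word_op D v i.
Proof.
move=> uv; elim: uv D => {u v} //.
- by move=> r /relator_op rE D; apply: rE.
- by move=> v u w _ e1 _ e2 D; rewrite e1.
- by move=> u1 u2 v1 v2 _ e1 _ e2 D; rewrite /word_op !foldr_cat -!/(word_op _ _ _) e2 e1.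
Qed.

Lemma elt_op_Gword D w i : elt_op D (Gword w) i = word_op D w i.
Proof. exact/word_op_cong/Grepr_Gword. Qed.

Lemma letter_opC l m D i j : i != j ->
  letter_op l (letter_op m D j) i = letter_op m (letter_op l D i) j.
Proof.
move=> /negPf ij; have ji : (j == i) = false by rewrite eq_sym.
apply/setP=> X; case: l; case: m => /=;
  rewrite !(in_twist, in_loop_compl) ?in_tog ?ij ?ji ?addbF (togC X j i) //.
by case: (i \in X); case: (j \in X); rewrite /= ?addbF // -!addbA;
   congr (_ (+) _); rewrite addbCA.
Qed.

Lemma elt_opC g h D i j : i != j ->
  elt_op (elt_op D h j) g i = elt_op (elt_op D g i) h j.
Proof.
move=> ij; rewrite /elt_op; elim: (Grepr g) => //= l u ->.
by elim: (Grepr h) => //= m v IHv; rewrite letter_opC // IHv.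
Qed.

Lemma Gamma_order D (g : Gn n) (s : seq 'I_n) :
  perm_eq s (enum 'I_n) ->
  Gamma D g = foldr (fun i E => elt_op E (g i) i) D s.
Proof.
set f := fun i => _; move=> s_perm.
have fC i j E : f i (f j E) = f j (f i E).
  by have [->//|ij] := eqVneq i j; apply: elt_opC.
have fsC i t E : foldr f (f i E) t = f i (foldr f E t).
  by elim: t => //= j t ->; rewrite fC.
apply/esym; apply/catCA_perm_subst: s_perm => s1 s2 s3.
by rewrite !foldr_cat; elim: s1 => //= i s1 ->; rewrite fsC.
Qed.

End SetSystemOperations.

(** Composition of permutations as functions; the library's product of
    permutations composes in the opposite order. *)
Definition pcomp (T : finType) (s t : {perm T}) : {perm T} := t * s.

Notation "s \oP t" := (pcomp s t) (at level 50, left associativity).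

Lemma pcompE (T : finType) (s t : {perm T}) : s \oP t =1 s \o t.
Proof. by move=> x; rewrite permM. Qed.

Definition precomp (n : nat) (g : Gn n) (s : 'S_n) : Gn n := [ffun i => g (s i)].

Lemma precompV_inj n (s : 'S_n) : injective (fun g : Gn n => precomp g s^-1).
Proof.
move=> g h /ffunP gh; apply/ffunP=> i.
by have := gh (s i); rewrite !ffunE permK.
Qed.

Definition phi (n : nat) (s : 'S_n) : {perm Gn n} := perm (@precompV_inj n s).

(** The external semidirect product of G^n by S_n along [f]; its carrier is the
    cartesian product, but its law is [semidirect_mul], not the library's
    componentwise product on pairs. *)
Definition semidirect (n : nat) : Type := Gn n * 'S_n.

Definition semidirect_mul (n : nat) (f : 'S_n -> {perm Gn n}) (x y : semidirect n) :
  semidirect n := (x.1 * f x.2 y.1, x.2 \oP y.2).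

Definition semidirect_one (n : nat) : semidirect n := (1, 1).

Definition group_law (T : Type) (mul : T -> T -> T) (one : T) : Prop :=
  [/\ associative mul, left_id one mul, right_id one mul &
      exists inv, left_inverse one inv mul /\ right_inverse one inv mul].

Definition left_action (T S : Type) (mul : T -> T -> T) (one : T)
    (act : T -> S -> S) : Prop :=
  (forall D, act one D = D) /\
  (forall x y D, act (mul x y) D = act x (act y D)).

(* Main.v *)
Require Import Defs.
From mathcomp Require Import all_boot all_fingroup.
Import GroupScope.

(** Relabelling by s turns an operation on the element i into the same operation
    on s i, so pi (g . D) = (g pi^-1) . (pi D).  As operations on distinct elements
    commute, (g o h) . D = g . (h . D), and these two rules give the action axiom
    for exactly the stated multiplication. *)

Set Implicit Arguments.
Unset Strict Implicit.
Unset Printing Implicit Defensive.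

Section ElementOperations.
Variable n : nat.
Implicit Types (D E : set_system n) (g h : Gn n) (i j : 'I_n) (s t : 'S_n).

Lemma elt_op1 D i : elt_op D 1 i = D.
Proof. exact: (elt_op_Gword D [::] i). Qed.

Lemma elt_opM D (x y : G) i : elt_op D (x * y) i = elt_op (elt_op D y i) x i.
Proof. by rewrite elt_op_Gword /word_op foldr_cat. Qed.

(** Every index in [r] differs from [i], so the operation on [i] slides past the fold one index at a
    time. *)
Lemma foldr_elt_opC g (x : G) D i (r : seq 'I_n) : i \notin r ->
  elt_op (foldr (fun j E => elt_op E (g j) j) D r) x i =
  foldr (fun j E => elt_op E (g j) j) (elt_op D x i) r.
Proof.
elim: r => //= j r IHr; rewrite inE negb_or => /andP[ij ir].
by rewrite elt_opC // IHr.
Qed.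

Lemma Gamma1 D : Gamma D 1 = D.
Proof.
by rewrite /Gamma; elim: (enum _) => //= i r ->; rewrite ffunE elt_op1.
Qed.

Lemma GammaM D g h : Gamma D (g * h) = Gamma (Gamma D h) g.
Proof.
rewrite /Gamma; elim: (enum 'I_n) (enum_uniq 'I_n) => //= i r IHr /andP[ir ur].
(* The product at [i] acts as [h i], then [g i]; as [i] is not in [r], the [h i] part moves inside
   the fold of [g] over [r]. *)
by rewrite IHr // ffunE elt_opM foldr_elt_opC.
Qed.

Lemma in_perm_sys s D (X : {set 'I_n}) : (X \in perm_sys s D) = (s @^-1: X \in D).
Proof.
(* Preimage undoes image, so taking images under [s] is injective, as [mem_imset] requires. *)
have sK : cancel (fun Y : {set 'I_n} => s @: Y) (preimset s \o mem).
  by move=> Y; apply/setP=> i; rewrite inE mem_imset //; apply: perm_inj.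
rewrite -[in LHS](_ : s @: (s @^-1: X) = X) ?mem_imset //; first exact: can_inj sK.
apply/setP=> i; rewrite -[i](permKV s) mem_imset ?inE //; exact: perm_inj.
Qed.

Lemma perm_sys1 D : perm_sys 1 D = D.
Proof.
apply/setP=> X; rewrite in_perm_sys; congr (_ \in D).
by apply/setP=> i; rewrite inE perm1.
Qed.

Lemma perm_sysM s t D : perm_sys (s \oP t) D = perm_sys s (perm_sys t D).
Proof.
apply/setP=> X; rewrite !in_perm_sys; congr (_ \in D).
by apply/setP=> i; rewrite !inE permM.
Qed.

(** Both letters are described through [tog], so this equivariance carries over to them. *)
Lemma preim_tog s (X : {set 'I_n}) i : s @^-1: tog X (s i) = tog (s @^-1: X) i.
Proof.
by apply/setP=> j; rewrite inE !in_tog inE (inj_eq (@perm_inj _ s)).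
Qed.

Lemma perm_sys_letter_op s l D i :
  perm_sys s (letter_op l D i) = letter_op l (perm_sys s D) (s i).
Proof.
apply/setP=> X; rewrite in_perm_sys; case: l => /=.
  by rewrite !in_twist in_perm_sys preim_tog.
by rewrite !in_loop_compl !in_perm_sys preim_tog inE.
Qed.

Lemma perm_sys_elt_op s (x : G) D i :
  perm_sys s (elt_op D x i) = elt_op (perm_sys s D) x (s i).
Proof.
by rewrite /elt_op; elim: (Grepr x) => //= l w <-; rewrite perm_sys_letter_op.
Qed.

Lemma perm_sys_Gamma s D g :
  perm_sys s (Gamma D g) = Gamma (perm_sys s D) (precomp g s^-1).
Proof.
(* Processing the right side in the order [map s (enum 'I_n)] lets the two folds match term by term:
   the operation at [s i] is then [g i]. *)
rewrite [RHS](Gamma_order _ _ (s := map s (enum 'I_n))); last first.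
  apply: uniq_perm (enum_uniq _) _.
    by rewrite map_inj_uniq ?enum_uniq //; apply: perm_inj.
  by move=> i; rewrite mem_enum -[i](permKV s) (mem_map perm_inj) mem_enum.
rewrite /Gamma; elim: (enum _) => //= i r <-.
by rewrite perm_sys_elt_op ffunE permK.
Qed.

End ElementOperations.

Lemma precompM n (g h : Gn n) (s : 'S_n) :
  precomp (g * h) s = precomp g s * precomp h s.
Proof. by apply/ffunP=> i; rewrite !ffunE. Qed.

Lemma phi_Aut n (s : 'S_n) : phi s \in Aut [set: Gn n].
Proof.
rewrite inE; apply/andP; split; first by apply/subsetP=> g; rewrite inE.
by apply/morphicP=> g h _ _; rewrite !permE precompM.
Qed.

(** Precomposition reverses order and so does inversion; the two reversals cancel. *)
Lemma phi_pcomp n (s t : 'S_n) : phi (s \oP t) = phi s \oP phi t.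
Proof.
apply/permP=> g; rewrite permM !permE; apply/ffunP=> i.
by rewrite !ffunE /pcomp invMg permM.
Qed.

Theorem proposition3p1 (n : nat) (n_gt0 : (0 < n)%N) :
  [/\ (forall s : 'S_n, phi s \in Aut [set: Gn n])
      /\ (forall s t : 'S_n, phi (s \oP t) = phi s \oP phi t),
      forall (g h : Gn n) (s t : 'S_n),
        semidirect_mul (@phi n) (g, s) (h, t) = (g * precomp h s^-1, s \oP t),
      group_law (semidirect_mul (@phi n)) (semidirect_one n) &
      left_action (semidirect_mul (@phi n)) (semidirect_one n)
        (fun (x : semidirect n) (D : set_system n) =>
           Gamma (perm_sys x.2 D) x.1)].
Proof.
have mulE (g h : Gn n) (s t : 'S_n) :
    semidirect_mul (@phi n) (g, s) (h, t) = (g * precomp h s^-1, s \oP t).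
  by rewrite /semidirect_mul /= permE.
have phi1 : phi (1 : 'S_n) = 1.
  apply/permP=> g; rewrite !permE; apply/ffunP=> i.
  by rewrite ffunE invg1 perm1.
have phiM (s : 'S_n) : {morph phi s : g h / g * h}.
  by move=> g h; rewrite !permE precompM.
have phig1 (s : 'S_n) : phi s 1 = 1.
  (* [phi s 1] is idempotent, hence trivial by cancellation. *)
  by apply: (mulgI (phi s 1)); rewrite -phiM !mulg1.
split=> //.
- by split; [apply: phi_Aut | apply: phi_pcomp].
- split.
  + move=> [g s] [h t] [k u]; rewrite /semidirect_mul /=.
    rewrite phiM phi_pcomp pcompE /= mulgA; congr (_, _).
    (* [\oP] is the reversed product, so associativity is used backwards. *)
    exact/esym/mulgA.
  + move=> [g s]; rewrite /semidirect_mul /= phi1 perm1 mul1g; congr (_, _).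
    exact: mulg1.
  + move=> [g s]; rewrite /semidirect_mul /= phig1 mulg1; congr (_, _).
    exact: mul1g.
  (* Solving [(k, t) (g, s) = (1, 1)] gives [t = s^-1] and [k = phi s^-1 g^-1]. *)
  + exists (fun x => (phi x.2^-1 x.1^-1, x.2^-1)); split=> -[g s];
      rewrite /semidirect_mul /=.
      by rewrite -phiM mulVg phig1; congr (_, _); apply: mulgV.
    have -> : phi s (phi s^-1 g^-1) = g^-1.
      by rewrite -[LHS](pcompE (phi s)) -phi_pcomp [s \oP _]mulVg phi1 perm1.
    by rewrite mulgV; congr (_, _); apply: mulVg.
- split=> [D | [g s] [h t] D]; first by rewrite Gamma1 perm_sys1.
  (* Moving [s] past the operations of [h] turns [h] into [precomp h s^-1], the twisted factor of
     the product. *)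
  by rewrite mulE /= perm_sysM GammaM perm_sys_Gamma.
Qed.
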